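(* Let $G$ be a weighted multigraph on $\{1,\dots,n\}$ with $v$ connected components and Laplacian matrix $L$, and let $L^+=(\ell^+_{ij})$ be the Moore--Penrose generalized inverse of $L$. Then \[ \ell^+_{ij}=\begin{cases}\dfrac{\varepsilon(\mathcal F^{ij}_{n-v-1})-\frac{1}{|V_i|}\varepsilon(\mathcal F_{n-v-1})}{\varepsilon(\mathcal F_{n-v})}, & \text{if } j\in V_i,\\[2mm] 0, & \text{otherwise.}\end{cases} \]
   Context: $G$ has edges with strictly positive weights $\varepsilon_{ij}^p$. The Laplacian $L=(\ell_{ij})$: $\ell_{ij}=-\sum_p\varepsilon_{ij}^p$ for $j\ne i$, $\ell_{ii}=-\sum_{j\ne i}\ell_{ij}$ (loops ignored). $V_i$ is the vertex set of the connected component of $G$ containing $i$. A spanning rooted forest of $G$ is an acyclic subgraph with vertex set $\{1,\dots,n\}$ with one marked vertex (root) in each tree. The weight of a subgraph is the product of its edge weights (1 if no edges); the weight $\varepsilon(\mathcal S)$ of a set of subgraphs is the sum of their weights (0 if the set is empty). $\mathcal F_k$ is the set of spanning rooted forests with exactly $k$ edges (empty for $k<0$); $\mathcal F^{ij}_k\subseteq\mathcal F_k$ consists of those forests in which $j$ belongs to the tree rooted at $i$. *)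

(* Defs.v *)
From mathcomp Require Import all_boot all_order all_algebra.

Set Implicit Arguments.
Unset Strict Implicit.
Unset Printing Implicit Defensive.

Import Order.TTheory GRing.Theory Num.Theory.
Local Open Scope ring_scope.

(** Undirected weighted multigraphs on the vertex set 'I_n. Edges are named by
    a finite type, so parallel edges are distinct elements of [edge]; loops are
    allowed. The order of the pair [ends e] is an artefact of the encoding and
    carries no orientation. *)
Record wmultigraph (R : realFieldType) (n : nat) := WMultigraph {
  edge : finType;
  ends : edge -> 'I_n * 'I_n;
  wt : edge -> R;
  wt_gt0 : forall e, 0 < wt e
}.

Section Defs.
Variables (R : realFieldType) (n : nat) (G : wmultigraph R n).
Implicit Types (F : {set edge G}) (i j : 'I_n) (k : int).

Definition joins (e : edge G) i j : bool :=
  (ends e == (i, j)) || (ends e == (j, i)).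

Definition offdiag i j : R := - \sum_(e | joins e i j) wt e.

Definition laplacian : 'M[R]_n :=
  \matrix_(i, j) if i == j then - \sum_(h | h != i) offdiag i h
                 else offdiag i j.

(** A spanning subgraph is given by its edge set. *)
Definition adj F : rel 'I_n := [rel i j | [exists e in F, joins e i j]].

(** Vertex set of the connected component of [i] in the spanning subgraph [F]. *)
Definition component F i : {set 'I_n} := [set j | connect (adj F) i j].

Definition ncomponents : nat := #|[set component [set: edge G] i | i : 'I_n]|.

(** A dart is an edge together with a direction of traversal. *)
Definition dart : finType := (edge G * bool)%type.
Definition dtail (d : dart) : 'I_n := if d.2 then (ends d.1).2 else (ends d.1).1.
Definition dhead (d : dart) : 'I_n := if d.2 then (ends d.1).1 else (ends d.1).2.

(** A cycle visits distinct vertices along distinct edges. A loop is a cycle of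
    length 1, and two parallel edges form a cycle of length 2. *)
Definition simple_cycle F (p : seq dart) : bool :=
  [&& p != [::], all (fun d => d.1 \in F) p,
      cycle (fun d d' => dhead d == dtail d') p,
      uniq [seq dtail d | d <- p] & uniq [seq d.1 | d <- p]].

(** The length bound loses nothing, as [acyclicP] shows. *)
Definition acyclic F : bool :=
  ~~ [exists m : 'I_n.+1, exists p : m.-tuple dart, simple_cycle F p].

Lemma acyclicP F : reflect (forall p, ~~ simple_cycle F p) (acyclic F).
Proof.
apply: (iffP idP) => [/existsPn acF p|acF]; last first.
  by apply/existsPn => m; apply/existsPn => p.
apply/negP => Cp; have /and5P[_ _ _ up _] := Cp.
have lt_p : (size p < n.+1)%N.
  by rewrite ltnS -(size_map dtail) (leq_trans (uniq_leq_size up (s2 := enum 'I_n) _))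
     ?size_enum_ord // => x _; rewrite mem_enum.
by have /existsPn/(_ (in_tuple p))/negP := acF (Ordinal lt_p).
Qed.

(** A rooted subgraph is a pair (edge set, set of roots). *)
Definition rooted_forest (f : {set edge G} * {set 'I_n}) : bool :=
  acyclic f.1 && [forall i, #|component f.1 i :&: f.2| == 1%N].

Definition forests k : {set {set edge G} * {set 'I_n}} :=
  [set f | rooted_forest f & #|f.1|%:Z == k].

Definition forests_at i j k : {set {set edge G} * {set 'I_n}} :=
  [set f in forests k | (i \in f.2) && (j \in component f.1 i)].

Definition weight (S : {set {set edge G} * {set 'I_n}}) : R :=
  \sum_(f in S) \prod_(e in f.1) wt e.

End Defs.

Section MoorePenrose.
Variables (R : realFieldType).

Definition moore_penrose m n (A : 'M[R]_(m, n)) (X : 'M[R]_(n, m)) : Prop :=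
  [/\ A *m X *m A = A, X *m A *m X = X,
      (A *m X)^T = A *m X & (X *m A)^T = X *m A].

Lemma moore_penrose_unique m n (A : 'M[R]_(m, n)) X Y :
  moore_penrose A X -> moore_penrose A Y -> X = Y.
Proof.
move=> [x1 x2 x3 x4] [y1 y2 y3 y4].
have E1 : A *m X = A *m Y.
  have: (A *m Y *m (A *m X))^T = A *m X by rewrite mulmxA y1 x3.
  by rewrite trmx_mul x3 y3 mulmxA x1.
have E2 : X *m A = Y *m A.
  have: (X *m A *m (Y *m A))^T = X *m A by rewrite -mulmxA (mulmxA A) y1 x4.
  by rewrite trmx_mul x4 y4 -mulmxA (mulmxA A) x1.
by rewrite -x2 E2 -mulmxA E1 mulmxA y2.
Qed.

Lemma gram_unit m n (A : 'M[R]_(m, n)) : row_free A -> A *m A^T \in unitmx.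
Proof.
move=> fA; rewrite -row_free_unit -kermx_eq0; apply/rowV0P => u /sub_kermxP u0.
apply: (row_free_inj fA); rewrite mul0mx.
have : (u *m A) *m (u *m A)^T = 0 by rewrite trmx_mul mulmxA -(mulmxA u) u0 mul0mx.
move: (u *m A) => w /matrixP/(_ 0 0) /eqP; rewrite !mxE psumr_eq0; last first.
  by move=> k _; rewrite mxE -expr2 sqr_ge0.
move=> /allP w0; apply/rowP => k; have := w0 k (mem_index_enum k).
by rewrite !mxE mulf_eq0 orbb => /eqP.
Qed.

Lemma moore_penrose_exists m n (A : 'M[R]_(m, n)) : exists X, moore_penrose A X.
Proof.
have [r [C [B [defA fB fC]]]] : exists r (C : 'M[R]_(m, r)) (B : 'M[R]_(r, n)),
    [/\ C *m B = A, row_free B & row_free C^T].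
  exists (\rank A), (col_base A), (row_base A).
  rewrite mulmx_base row_base_free; split => //.
  by rewrite /row_free mxrank_tr; apply: col_base_full.
have uB : B *m B^T \in unitmx by apply: gram_unit.
have uC : C^T *m C \in unitmx by rewrite -{2}[C]trmxK; apply: gram_unit.
set P := invmx (B *m B^T); set Q := invmx (C^T *m C).
have tP : P^T = P by rewrite trmx_inv trmx_mul trmxK.
have tQ : Q^T = Q by rewrite trmx_inv trmx_mul trmxK.
pose X := B^T *m P *m Q *m C^T.
have AX : A *m X = C *m Q *m C^T.
  by rewrite -defA /X !mulmxA -(mulmxA C B) -(mulmxA C) mulmxV // mulmx1.
have XA : X *m A = B^T *m P *m B.
  by rewrite -defA /X !mulmxA -(mulmxA _ C^T C) -(mulmxA _ Q) mulVmx // mulmx1.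
exists X; split.
- by rewrite AX -defA !mulmxA -(mulmxA _ C^T C) -(mulmxA C Q) mulVmx // mulmx1.
- by rewrite XA /X !mulmxA -(mulmxA _ B) -(mulmxA B^T P) mulVmx // mulmx1.
- by rewrite AX !trmx_mul trmxK tQ mulmxA.
- by rewrite XA !trmx_mul trmxK tP mulmxA.
Qed.

End MoorePenrose.

(* Main.v *)
Require Import Defs.
From mathcomp Require Import all_boot all_order all_fingroup all_algebra ring.

Import Order.TTheory GRing.Theory Num.Theory.
Local Open Scope ring_scope.

(** Let Q_k be the matrix with entries weight (forests_at G i j k), let
    s_k = weight (forests G k), d = n - v, and let J be the orthogonal projector
    averaging over connected components. The key identity is
    Q_k L = s_{k+1} - Q_{k+1}. In column j it comes from cutting the first edge
    on the path from a non-root vertex j to its root: a forest with k+1 edges in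
    which j is not a root is a forest with k edges in which j is a root, plus an
    edge from j to another tree. Splitting Q_k on the left by whether j is a
    root, the first part gives the right-hand side, and the second part is a sum
    over pairs of edges at j that is antisymmetric under swapping them.
    Since the forests with d edges have the components of G as their trees,
    Q_d = s_d J, so X = (Q_{d-1} - s_{d-1} J) / s_d satisfies X L = 1 - J; as X,
    L and J are symmetric with J L = 0 and J X = 0, X is the Moore-Penrose
    inverse of L. *)

Section Graph.
Set Implicit Arguments.
Unset Strict Implicit.
Variables (R : realFieldType) (n : nat) (G : wmultigraph R n).
Implicit Types (F H : {set edge G}) (e : edge G) (i j h x y : 'I_n) (k : int).
Implicit Types (f g : {set edge G} * {set 'I_n}).

(** * Edges and connectivity *)

Lemma joinsC e i j : joins e i j = joins e j i.
Proof. by rewrite /joins orbC. Qed.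

Lemma joins_inj e j h h' : joins e j h -> joins e j h' -> h = h'.
Proof.
by rewrite /joins => /orP[]/eqP-> /orP[]/eqP[] *; congruence.
Qed.

Lemma joins_eq e i j x y : joins e i j -> joins e x y ->
  (x = i /\ y = j) \/ (x = j /\ y = i).
Proof. by rewrite /joins => /orP[]/eqP-> /orP[]/eqP[<- <-]; auto. Qed.

Lemma joins_ends e : joins e (ends e).1 (ends e).2.
Proof. by rewrite /joins -surjective_pairing eqxx. Qed.

Lemma adjP F i j : reflect (exists2 e, e \in F & joins e i j) (adj F i j).
Proof. exact: exists_inP. Qed.

Lemma adj_sym F : connect_sym (adj F).
Proof.
apply: sym_connect_sym => i j /=.
by apply: eq_existsb => e; rewrite joinsC.
Qed.

Lemma connect_joins F e i j : e \in F -> joins e i j -> connect (adj F) i j.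
Proof. by move=> eF eij; apply/connect1/adjP; exists e. Qed.

Lemma connect_subset F H i j :
  F \subset H -> connect (adj F) i j -> connect (adj H) i j.
Proof.
move=> sFH; apply: connect_sub => x y /adjP[e eF exy].
exact: (connect_joins (subsetP sFH _ eF) exy).
Qed.

(** A path need cross the new edge at most once, in one direction or the other. *)
Lemma connect_add H e j h x y : joins e j h ->
  connect (adj (e |: H)) x y =
  [|| connect (adj H) x y, connect (adj H) x j && connect (adj H) h y
    | connect (adj H) x h && connect (adj H) j y].
Proof.
move=> ejh; have sH : H \subset e |: H by apply: subsetUr.
have cjh : connect (adj (e |: H)) j h by apply: connect_joins ejh; rewrite setU11.
apply/idP/idP => [|/or3P[|/andP[xj hy]|/andP[xh jy]]]; first last.
- apply: connect_trans (connect_subset sH xh) _; rewrite adj_sym.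
  by apply: connect_trans cjh; rewrite adj_sym; apply: connect_subset jy.
- apply: connect_trans (connect_subset sH xj) _.
  by apply: connect_trans cjh _; apply: connect_subset hy.
- exact: connect_subset.
case/connectP=> p + ->; elim/last_ind: p => [|p z IHp] //=.
  by rewrite connect0.
rewrite rcons_path last_rcons => /andP[/IHp{IHp}]; set w := last x p.
move=> IHw /adjP[e' /setU1P[->|e'H] e'wz]; last first.
  have wz := connect_joins e'H e'wz.
  case/or3P: IHw => [xw|/andP[-> hw]|/andP[-> jw]].
  - by rewrite (connect_trans xw wz).
  - by rewrite (connect_trans hw wz) orbT.
  - by rewrite (connect_trans jw wz) !orbT.
case: (joins_eq ejh e'wz) => -[ew ->]; move: IHw; rewrite ew !connect0 !andbT.
- by case/or3P => [->|/andP[-> _]|->]; rewrite ?orbT.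
- by case/or3P => [->|->|/andP[-> _]]; rewrite ?orbT.
Qed.

(** * Darts, cycles and bridges *)

Lemma dart_joins (d : dart G) : joins d.1 (dtail d) (dhead d).
Proof.
by case: d => e []; rewrite /dtail /dhead /=; [rewrite joinsC|]; apply: joins_ends.
Qed.

Lemma joins_dart e i j : joins e i j ->
  exists d : dart G, [/\ d.1 = e, dtail d = i & dhead d = j].
Proof.
case/orP=> /eqP E; [exists (e, false)|exists (e, true)];
  by rewrite /dtail /dhead E.
Qed.

(** Prepares the cycle in [bridgeP], where the closing dart plays [d0]. The last clause keeps the
    edges distinct in the induction: the first edge is at [x], which later darts avoid. *)
Lemma path_darts F x p : path (adj F) x p -> uniq (x :: p) ->
  exists q : seq (dart G),
    [/\ all (fun d => d.1 \in F) q,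
        forall d0, dhead d0 = x ->
          path (fun d d' => dhead d == dtail d') d0 q /\
          dhead (last d0 q) = last x p,
        [seq dtail d | d <- q] = belast x p,
        uniq [seq d.1 | d <- q]
      & {in q, forall d, dtail d \in x :: p /\ dhead d \in x :: p}].
Proof.
elim: p x => [|y p IHp] x /=; first by exists [::].
case/andP=> /adjP[e eF exy] yp /andP[xyp uyp].
have [q [qF qP qt uq qyp]] := IHp _ yp uyp.
have [d [de dx dy]] := joins_dart exy.
exists (d :: q); split=> /=.
- by rewrite de eF.
- by move=> d0 d0x; rewrite d0x dx eqxx; apply: qP.
- by rewrite dx qt.
- rewrite uq andbT; apply/mapP => -[d' d'q dd'].
  have := dart_joins d'; rewrite -dd' de => /(joins_eq exy) eqd.
  by have [] := qyp _ d'q; case: eqd => -[-> ->]; rewrite (negPf xyp).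
- move=> d'; rewrite !inE => /orP[/eqP->|/qyp[]]; last first.
    by rewrite !inE => -> ->; rewrite !orbT.
  by rewrite dx dy !eqxx !orbT.
Qed.

Lemma path_avoid F e j h x p : joins e j h -> j \notin x :: p ->
  path (adj F) x p -> path (adj (F :\ e)) x p.
Proof.
move=> ejh; elim: p x => //= y p IHp x jxyp /andP[/adjP[e' e'F xy] yp].
move: (jxyp); rewrite inE negb_or => /andP[jx jyp]; rewrite IHp // andbT.
apply/adjP; exists e' => //; rewrite in_setD1 e'F andbT.
apply: contraNneq jxyp => e'e; rewrite e'e in xy.
by case: (joins_eq ejh xy) => -[-> ->]; rewrite !inE eqxx ?orbT.
Qed.

Lemma dart_path_connect F (d0 : dart G) q :
  path (fun d d' => dhead d == dtail d') d0 q -> all (fun d => d.1 \in F) q ->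
  connect (adj F) (dhead d0) (dhead (last d0 q)).
Proof.
elim: q d0 => [|d q IHq] d0 /=; first by rewrite connect0.
case/andP=> /eqP-> dq /andP[dF qF].
exact: connect_trans (connect_joins dF (dart_joins d)) (IHq _ dq qF).
Qed.

(** A cycle without one of its edges still joins the ends of that edge; conversely, a simple path
    joining the ends of [e] without using [e] closes up to a simple cycle. *)
Lemma bridgeP F : reflect
  {in F, forall e i j, joins e i j -> ~~ connect (adj (F :\ e)) i j} (acyclic F).
Proof.
apply: (iffP (acyclicP F)) => [acF e eF i j eij|brF [|d p]]; last first.
- apply/negP => /and5P[_ /= /andP[dF pF] cyc _ /andP[dp _]].
  move: cyc; rewrite rcons_path => /andP[dpath dlast].
  have := brF _ dF _ _ (dart_joins d); rewrite adj_sym -(eqP dlast).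
  rewrite (dart_path_connect dpath) //; apply/allP => d' d'p.
  rewrite in_setD1 (allP pF) // andbT; apply: contraNneq dp => <-.
  exact: map_f.
- by rewrite /simple_cycle eqxx.
apply/negP; rewrite adj_sym => /connectP[p jp ip].
case/shortenP: jp ip => p' jp' up' _ ip'.
have [q [qF qP qt uq _]] := path_darts jp' up'.
have [d [de dx dy]] := joins_dart eij.
have [dq lq] := qP _ dy.
have /negP[] := acF (d :: q); apply/and5P; split=> //=.
- rewrite de eF; apply: sub_all qF => d'; by rewrite in_setD1 => /andP[].
- by rewrite rcons_path dq lq dx ip' eqxx.
- by rewrite qt dx ip' -rcons_uniq -lastI.
- rewrite uq andbT de; apply/mapP => -[d' /(allP qF) + dd'].
  by rewrite -dd' in_setD1 eqxx.
Qed.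

Lemma acyclic_subset F H : H \subset F -> acyclic F -> acyclic H.
Proof.
move=> sHF /bridgeP acF; apply/bridgeP => e eH i j eij.
apply: contra (acF _ (subsetP sHF _ eH) _ _ eij).
exact/connect_subset/setSD.
Qed.

(** * Rooted forests, grafting and pruning *)

Lemma rooted_forestP f : reflect
  [/\ acyclic f.1, forall x, exists2 r, r \in f.2 & connect (adj f.1) x r
    & {in f.2 &, forall r s, connect (adj f.1) r s -> r = s}]
  (rooted_forest f).
Proof.
case: f => F S /=; apply: (iffP andP) => -[acF] /=; last first.
  move=> exS unS; split=> //; apply/forallP => i.
  have [r rS ir] := exS i; apply/cards1P; exists r; apply/setP => s.
  rewrite !inE; apply/andP/eqP => [[is_ sS]|->] //.
  by apply: unS => //; rewrite adj_sym in is_; apply: connect_trans is_ ir.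
move=> /forallP rtF; split=> // [x|r s rS sS rs].
  have /cards1P[r /setP/(_ r)] := rtF x.
  by rewrite !inE eqxx => /andP[]; exists r.
have /cards1P[t /setP tP] := rtF r.
have := tP r; have := tP s; rewrite !inE rS sS rs connect0.
by move=> /esym/eqP-> /esym/eqP->.
Qed.

(** Hanging the tree rooted at [j] on another tree by [e] costs [j] its root status; cutting [e]
    restores it. *)
Definition graft e j g : {set edge G} * {set 'I_n} := (e |: g.1, g.2 :\ j).
Definition prune e j f : {set edge G} * {set 'I_n} := (f.1 :\ e, j |: f.2).

(** [e] joins two different trees, so it closes no cycle, and the merged tree keeps only the root of
    the tree of [h]. *)
Lemma graft_rooted_forest e j h g :
  rooted_forest g -> j \in g.2 -> joins e j h -> ~~ connect (adj g.1) j h ->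
  rooted_forest (graft e j g).
Proof.
case: g => H S /rooted_forestP[/bridgeP/= brH exS unS] jS ejh /= Njh.
have eH : e \notin H by apply: contra Njh => eH; apply: connect_joins ejh.
apply/rooted_forestP; split=> /=.
- apply/bridgeP => e' /setU1P[->|e'H] x y e'xy.
    by rewrite setU1K //; case: (joins_eq ejh e'xy) => -[-> ->] //; rewrite adj_sym.
  have e'e : e' != e by apply: contraTneq e'H => ->.
  have -> : (e |: H) :\ e' = e |: (H :\ e').
    apply/setP => z; rewrite !inE; case: (eqVneq z e) => [->|_] //=.
    by rewrite eq_sym e'e.
  have sub : H :\ e' \subset H by apply: subD1set.
  have cxy := connect_joins e'H e'xy.
  rewrite (connect_add _ _ _ ejh) (negPf (brH _ e'H _ _ e'xy)) /=.
  apply: contra Njh => /orP[]/andP[/(connect_subset sub) c1 /(connect_subset sub) c2].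
    by rewrite adj_sym; apply: connect_trans c2 (connect_trans _ c1); rewrite adj_sym.
  by apply: connect_trans c2 (connect_trans _ c1); rewrite adj_sym.
- move=> x; have [r rS xr] := exS x.
  have [rj|rj] := eqVneq r j; last first.
    by exists r; rewrite ?inE ?rj ?(connect_add _ _ _ ejh) ?xr.
  have [s sS hs] := exS h; exists s; last first.
    by rewrite (connect_add _ _ _ ejh) -rj xr hs orbT.
  by rewrite !inE sS andbT; apply: contra Njh => /eqP<-; rewrite adj_sym.
- move=> r s /setD1P[rj rS] /setD1P[sj sS].
  rewrite (connect_add _ _ _ ejh) => /or3P[|/andP[rj' _]|/andP[_ js]].
  + exact: unS.
  + by rewrite (unS _ _ rS jS rj') eqxx in rj.
  + by rewrite -(unS _ _ jS sS js) eqxx in sj.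
Qed.

(* [e] is the first edge, and [h] the second vertex, on the path in [f] from the
   non-root vertex [j] to its root. *)
Definition parent e j h f :=
  [&& e \in f.1, joins e j h, ~~ connect (adj (f.1 :\ e)) j h
    & rooted_forest (prune e j f)].

(** The first edge [e] of a simple path from [j] to its root [r] is a bridge; cutting it leaves [h]
    with [r], so [j] can be the root of the other part. *)
Lemma parent_exists f j : rooted_forest f -> j \notin f.2 ->
  exists e h, parent e j h f.
Proof.
case: f => F S /rooted_forestP[/= acF exS unS] jS.
have [r rS /connectP[p0 jp0 rp0]] := exS j.
case/shortenP: jp0 rp0 => -[|h p] /=; first by move=> _ _ _ rj; rewrite -rj rS in jS.
case/andP=> /adjP[e eF ejh] /(path_avoid ejh) hp /andP[/hp{}hp _] _ rp.
have Njh := bridgeP _ acF _ eF _ _ ejh.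
have hr : connect (adj (F :\ e)) h r.
  by rewrite rp; apply/connectP; exists p.
have FE : F = e |: (F :\ e) by rewrite setD1K.
exists e, h; apply/and4P; split=> //; apply/rooted_forestP; split=> /=.
- exact: acyclic_subset (subD1set _ _) acF.
- move=> x; have [s sS] := exS x; rewrite {1}FE (connect_add _ _ _ ejh).
  case/or3P=> [xs|/andP[xj _]|/andP[xh js]].
  + by exists s; rewrite ?inE ?sS ?orbT.
  + by exists j; rewrite ?setU11.
  + exists r; rewrite ?inE ?rS ?orbT //; exact: connect_trans xh hr.
(* An old root still joined to [j] would be [r], which is joined to [h]; then [e] would be no
   bridge. *)
- have jP s : s \in S -> ~~ connect (adj (F :\ e)) j s.
    move=> sS; apply: contra Njh => js.
    have sub : F :\ e \subset F by apply: subD1set.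
    have rs : r = s.
      apply: unS => //; apply: connect_trans (connect_subset sub js).
      rewrite adj_sym; apply: connect_trans (connect_joins eF ejh) _.
      exact: connect_subset hr.
    by apply: connect_trans js _; rewrite adj_sym -rs.
  move=> s t /setU1P[->|sS] /setU1P[->|tS] //.
  + by rewrite (negPf (jP _ tS)).
  + by rewrite adj_sym (negPf (jP _ sS)).
  + by move=> /(connect_subset (subD1set _ _)); apply: unS.
Qed.

(** If [e] and [e'] differed, [h] and [h'] would reach the same old root without either edge, so
    [e'] would lead from [j] to [h] avoiding [e]. *)
Lemma parent_unique f j e h e' h' : rooted_forest f -> j \notin f.2 ->
  parent e j h f -> parent e' j h' f -> (h, e) = (h', e').
Proof.
case: f => F S /rooted_forestP[/= acF exS unS] jS.
case/and4P=> /= eF ejh Njh /rooted_forestP[/= _ exH unH].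
case/and4P=> /= e'F e'jh' Njh' /rooted_forestP[/= _ exH' unH'].
have [ee'|ee'] := eqVneq e e'.
  by rewrite -ee' in e'jh' *; rewrite (joins_inj ejh e'jh').
pose K := F :\ e :\ e'.
have HE : F :\ e = e' |: K by rewrite setD1K // !inE eq_sym ee'.
have H'E : F :\ e' = e |: K.
  have -> : K = F :\ e' :\ e by apply/setP => z; rewrite !inE andbCA.
  by rewrite setD1K // !inE ee'.
have KH : K \subset F :\ e by rewrite HE subsetUr.
(* A path from [x] to its root in [F :\ a] cannot use [b]: it would pass through [j], which lies in
   another tree. *)
have root_of a x b y : a \in F -> joins a j x -> ~~ connect (adj (F :\ a)) j x ->
    {in j |: S &, forall r s, connect (adj (F :\ a)) r s -> r = s} ->
    (forall z, exists2 r, r \in j |: S & connect (adj (F :\ a)) z r) ->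
    F :\ a = b |: K -> joins b j y ->
    exists r, [/\ r \in S, connect (adj K) x r & connect (adj F) j r].
  move=> aF ajx Njx un ex FaE bjy; have KFa : K \subset F :\ a by rewrite FaE subsetUr.
  have [r /setU1P[->|rS] xr] := ex x; first by rewrite adj_sym xr in Njx.
  exists r; split=> //; last first.
    apply: connect_trans (connect_joins aF ajx) _.
    exact: connect_subset (subD1set _ _) xr.
  move: xr; rewrite FaE (connect_add _ _ _ bjy) => /or3P[] //.
    by case/andP=> /(connect_subset KFa); rewrite adj_sym (negPf Njx).
  case/andP=> _ /(connect_subset KFa) jr.
  by rewrite (un j r) ?setU11 ?setU1r // rS in jS.
have [r [rS hr jr]] := root_of _ _ _ _ eF ejh Njh unH exH HE e'jh'.
have [s [sS h's js]] := root_of _ _ _ _ e'F e'jh' Njh' unH' exH' H'E ejh.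
have rs : r = s by apply: unS => //; apply: connect_trans js; rewrite adj_sym.
case/negP: Njh; apply: (@connect_trans _ _ h').
  by apply: connect_joins e'jh'; rewrite HE setU11.
rewrite adj_sym; apply: connect_subset KH _; apply: connect_trans hr _.
by rewrite rs adj_sym.
Qed.

(** Each [f] is counted once through its unique parent pair, and pruning the edge of that pair
    inverts grafting it. *)
Lemma sum_nonroot k j (Phi : {set edge G} * {set 'I_n} -> R) :
  \sum_(f in forests G (k + 1) | j \notin f.2) Phi f =
  \sum_(g in forests G k | j \in g.2)
    \sum_(p : edge G * 'I_n | joins p.1 j p.2 && ~~ connect (adj g.1) j p.2)
      Phi (graft p.1 j g).
Proof.
transitivity (\sum_(f in forests G (k + 1) | j \notin f.2)
    \sum_(p : edge G * 'I_n | parent p.1 j p.2 f) Phi f).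
  apply: eq_bigr => f /andP[]; rewrite inE => /andP[rf _] jf.
  have [e [h ef]] := parent_exists rf jf.
  rewrite (big_pred1 (e, h)) // => -[e' h'] /=.
  apply/idP/eqP => [e'f|[-> ->] //].
  by have [-> ->] := parent_unique rf jf ef e'f.
rewrite (exchange_big_dep xpredT) //= [RHS](exchange_big_dep xpredT) //=.
apply: eq_bigr => -[e h] _ /=.
rewrite (reindex_onto (graft e j) (prune e j)) /=; last first.
  case=> F S /= /andP[/andP[_ jS] /and4P[/= eF _ _ _]].
  by rewrite /graft /prune /= setD1K // setU1K.
apply: eq_bigl => -[H S]; rewrite /parent /graft /prune !inE /= eqxx /= !andbT.
have cardE : e \notin H -> (#|e |: H|%:Z == k + 1) = (#|H|%:Z == k).
  by move=> eH; rewrite cardsU1 eH PoszD addrC (inj_eq (addIr _)).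
apply/idP/idP.
  case/andP=> /and5P[/andP[_ cH] _ ejh Njh rg] /eqP[HE SE].
  have eH : e \notin H by rewrite -HE !inE eqxx.
  rewrite HE SE in rg Njh; rewrite rg ejh Njh -cardE // cH.
  by rewrite -SE setU11.
case/andP=> /andP[/andP[rg cH] jS] /andP[ejh Njh].
have eH : e \notin H by apply: contra Njh => eH; apply: connect_joins ejh.
rewrite setU1K // setD1K // rg ejh Njh cardE // cH !eqxx !andbT.
exact: (graft_rooted_forest rg jS ejh Njh).
Qed.

(** * Forest weights and their recursion in the number of edges *)

Definition edges_weight f : R := \prod_(e in f.1) wt e.

Lemma edges_weight_graft e j h g : joins e j h -> ~~ connect (adj g.1) j h ->
  edges_weight (graft e j g) = wt e * edges_weight g.
Proof.
move=> ejh Njh; rewrite /edges_weight big_setU1 //=.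
by apply: contra Njh => eH; apply: connect_joins ejh.
Qed.

Definition in_tree i x f : R := ((i \in f.2) && connect (adj f.1) i x)%:R.

(** With membership as a factor, sums for different [i] and [j] run over the same forests. *)
Lemma weight_forests_at i j k : weight (forests_at G i j k) =
  \sum_(f in forests G k) edges_weight f * in_tree i j f.
Proof.
rewrite /weight (eq_bigl (fun f => (f \in forests G k) &&
  ((i \in f.2) && connect (adj f.1) i j))); last by move=> f; rewrite !inE.
rewrite big_mkcondr; apply: eq_bigr => f _.
by rewrite /in_tree; case: ifP; rewrite ?mulr1 ?mulr0.
Qed.

Lemma roots_disconnected f i j : rooted_forest f -> i \in f.2 -> j \in f.2 ->
  i != j -> ~~ connect (adj f.1) i j.
Proof.
by case/rooted_forestP=> _ _ unS iS jS; apply: contra => /(unS _ _ iS jS)->.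
Qed.

(** When [i] is a root, its tree gains the tree of [j] exactly if it contains [h]; the roots [i] and
    [j] lie in different trees of [g]. *)
Lemma in_tree_graft g i j e h x : rooted_forest g -> j \in g.2 -> i != j ->
  joins e j h ->
  in_tree i x (graft e j g) = ((i \in g.2) &&
    (connect (adj g.1) i x || connect (adj g.1) i h && connect (adj g.1) j x))%:R.
Proof.
move=> rg jg ij ejh; rewrite /in_tree /= !inE ij /= (connect_add _ _ _ ejh).
have [ig|//] := boolP (i \in g.2).
by rewrite (negPf (roots_disconnected rg ig jg ij)).
Qed.

(** Swapping [p] and [q] changes the sign of the summand. *)
Lemma sum_antisymmetric (I : finType) (P : pred I) (w : I -> R) (u v : I -> R) :
  \sum_(p | P p) \sum_(q | P q) w p * w q * (u p * v q - u q * v p) = 0.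
Proof.
under eq_bigr => p _ do under eq_bigr => q _ do rewrite mulrBr.
under eq_bigr => p _ do rewrite sumrB.
rewrite sumrB [X in _ - X]exchange_big /= -sumrB big1 // => p _.
rewrite -sumrB big1 // => q _; rewrite [w q * w p]mulrC; exact: subrr.
Qed.

Lemma forest_recursion_offdiag k i j : i != j ->
  \sum_(p : edge G * 'I_n | joins p.1 j p.2) wt p.1 *
    (weight (forests_at G i p.2 k) - weight (forests_at G i j k)) =
  weight (forests_at G i j (k + 1)).
Proof.
move=> ij.
transitivity (\sum_(f in forests G k) edges_weight f *
   \sum_(p : edge G * 'I_n | joins p.1 j p.2)
      wt p.1 * (in_tree i p.2 f - in_tree i j f)).
  under [RHS]eq_bigr => f _ do rewrite mulr_sumr.
  rewrite [RHS]exchange_big; apply: eq_bigr => p _.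
  rewrite !weight_forests_at -sumrB mulr_sumr; apply: eq_bigr => f _.
  by rewrite -mulrBr mulrCA.
(* The forests with [j] as a root give the right-hand side; the others, set aside here, are shown
   below to cancel. *)
rewrite (bigID (fun f => j \in f.2)) /= [X in _ + X](_ : _ = 0) ?addr0.
  rewrite weight_forests_at [RHS](bigID (fun f => j \notin f.2)) /=.
  rewrite [X in _ = _ + X]big1 ?addr0; last first.
    move=> f /andP[]; rewrite inE negbK => /andP[rf _] jf; rewrite /in_tree.
    have [iS /=|_] := boolP (i \in f.2); last by rewrite mulr0.
    by rewrite (negPf (roots_disconnected rf iS jf ij)) mulr0.
  (* With [j] a root of [g], the difference is the indicator that [p.2] is in the tree of [i], which
     is when grafting along [p] brings [j] there. *)
  rewrite sum_nonroot; apply: eq_bigr => g /andP[]; rewrite inE => /andP[rg _] jg.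
  rewrite mulr_sumr [RHS]big_mkcondr; apply: eq_bigr => p ejp.
  rewrite (in_tree_graft _ rg jg ij ejp) connect0 andbT /in_tree.
  have [ig|ig] /= := boolP (i \in g.2); last first.
    by rewrite subrr !mulr0; case: ifP.
  rewrite (negPf (roots_disconnected rg ig jg ij)) subr0 /=.
  case: ifPn => [Njp|]; first by rewrite (edges_weight_graft ejp) // mulrCA mulrA.
  rewrite negbK => jp; have [ip|_] := boolP (connect _ i _); last by rewrite !mulr0.
  have := roots_disconnected rg ig jg ij.
  by rewrite (connect_trans ip) // adj_sym.
(* A forest with [j] not a root is a graft of one with [k - 1] edges; indices are integers, so
   [k = 0] is covered. *)
rewrite -[k](subrK 1) sum_nonroot big1 // => g /andP[]; rewrite inE => /andP[rg _] jg.
rewrite big_mkcondr.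
(* [u] marks edges leading into the tree of [i], [v] those leading out of the tree of [j]. After
   grafting along [p], the difference along [q] is [u q - v q * u p]; if [v p = 0] then [u p = 0]
   too. *)
pose u (p : edge G * 'I_n) : R := ((i \in g.2) && connect (adj g.1) i p.2)%:R.
pose v (p : edge G * 'I_n) : R := (~~ connect (adj g.1) j p.2)%:R.
pose w (p : edge G * 'I_n) : R := wt p.1.
have disj x : i \in g.2 -> connect (adj g.1) j x -> ~~ connect (adj g.1) i x.
  move=> ig jx; apply: contra (roots_disconnected rg ig jg ij) => ix.
  by apply: connect_trans ix _; rewrite adj_sym.
transitivity (edges_weight g * \sum_(p : edge G * 'I_n | joins p.1 j p.2)
    \sum_(q : edge G * 'I_n | joins q.1 j q.2) w p * w q * (v p * u q - v q * u p));
  last by rewrite sum_antisymmetric mulr0.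
rewrite mulr_sumr; apply: eq_bigr => p ejp; rewrite {}/u {}/v {}/w.
case: ifPn => [Njp|]; last first.
  rewrite negbK => jp; rewrite big1 ?mulr0 // => q _; rewrite mul0r.
  have [ig|_] := boolP (i \in g.2); last by rewrite /= mulr0 subrr mulr0.
  by rewrite (negPf (disj _ ig jp)) /= mulr0 subrr mulr0.
rewrite (edges_weight_graft ejp) // !mulr_sumr; apply: eq_bigr => q _.
rewrite !(in_tree_graft _ rg jg ij ejp) connect0 andbT.
have [ig|_] /= := boolP (i \in g.2); last by ring.
rewrite (negPf (roots_disconnected rg ig jg ij)) /=.
have [jq|_] /= := boolP (connect _ j q.2); last by rewrite andbF orbF; ring.
by rewrite (negPf (disj _ ig jq)) andbT /=; ring.
Qed.

(** Only forests with [j] as a root contribute, and the difference then indicates that [p.2] is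
    outside the tree of [j], which is when grafting along [p] is allowed. No antisymmetric remainder
    appears. *)
Lemma forest_recursion_diag k j :
  \sum_(p : edge G * 'I_n | joins p.1 j p.2) wt p.1 *
    (weight (forests_at G j j k) - weight (forests_at G j p.2 k)) =
  weight (forests G (k + 1)) - weight (forests_at G j j (k + 1)).
Proof.
have -> : weight (forests G (k + 1)) - weight (forests_at G j j (k + 1)) =
    \sum_(f in forests G (k + 1) | j \notin f.2) edges_weight f.
  rewrite weight_forests_at -sumrB [RHS]big_mkcondr; apply: eq_bigr => f _.
  rewrite /in_tree connect0 andbT.
  by case: (j \in f.2); rewrite /= ?mulr1 ?mulr0 ?subrr ?subr0.
rewrite sum_nonroot.
under [RHS]eq_bigr => g _ do rewrite big_mkcondr.
rewrite [RHS]exchange_big; apply: eq_bigr => p ejp /=.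
rewrite !weight_forests_at -sumrB mulr_sumr [RHS]big_mkcondr.
apply: eq_bigr => g _; rewrite /in_tree connect0 andbT.
case: (j \in g.2); last by rewrite /= !mulr0 subrr mulr0.
have [_|Njp] /= := boolP (connect _ j p.2); first by rewrite subrr mulr0.
by rewrite (edges_weight_graft ejp) //= mulr1 mulr0 subr0.
Qed.

(** * Multiplication by the Laplacian *)

Lemma offdiagC i j : offdiag G i j = offdiag G j i.
Proof. by congr (- _); apply: eq_bigl => e; rewrite joinsC. Qed.

(** The diagonal entry is spread over the edges at [j]. Loops may be included, as they give
    [M i j - M i j]. *)
Lemma mulmx_laplacian (M : 'M[R]_n) i j : (M *m laplacian G) i j =
  \sum_(p : edge G * 'I_n | joins p.1 j p.2) wt p.1 * (M i j - M i p.2).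
Proof.
rewrite mxE (bigD1 j) //= [laplacian G j j]mxE eqxx mulrN mulr_sumr.
rewrite [X in _ + X](eq_bigr (fun h => M i h * offdiag G j h)); last first.
  by move=> h hj; rewrite [laplacian G h j]mxE (negPf hj) offdiagC.
rewrite addrC -sumrB big_mkcond /=.
rewrite -(pair_big_dep xpredT (fun e h => joins e j h)
  (fun e h => wt e * (M i j - M i h))) /=.
rewrite [RHS](exchange_big_dep xpredT) //=; apply: eq_bigr => h _.
have [->|_] /= := eqVneq h j; first by rewrite big1 // => e _; rewrite subrr mulr0.
by rewrite -mulrBl mulrN -mulNr opprB mulrC mulr_suml.
Qed.

(** * Rerooting and root counts *)

(* Written with a transposition so that it is an involution on all pairs. *)
Definition move_root i j f : {set edge G} * {set 'I_n} := (f.1, tperm i j @^-1: f.2).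

Lemma move_rootK i j : involutive (move_root i j).
Proof. by case=> F S; congr pair; apply/setP => x; rewrite !inE tpermK. Qed.

Lemma move_root_rooted_forest i j f : rooted_forest f -> connect (adj f.1) i j ->
  rooted_forest (move_root i j f).
Proof.
move=> /rooted_forestP[acF exS unS] ij.
have ct x : connect (adj f.1) x (tperm i j x).
  by case: tpermP => [->|->|_ _]; rewrite ?connect0 // adj_sym.
apply/rooted_forestP; split=> //= [x|r s].
  have [r rS xr] := exS x; exists (tperm i j r); first by rewrite inE tpermK.
  exact: connect_trans xr (ct r).
rewrite !inE => rS sS rs; apply: (@perm_inj _ (tperm i j)); apply: unS => //.
apply: connect_trans (ct s); apply: connect_trans rs.
by rewrite adj_sym.
Qed.

(** Moving the root within the tree that contains both [i] and [j] is a weight-preserving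
    bijection. *)
Lemma weight_forests_atC i j k :
  weight (forests_at G i j k) = weight (forests_at G j i k).
Proof.
have swap x y f : f \in forests_at G x y k -> move_root x y f \in forests_at G y x k.
  rewrite !inE => /andP[/andP[rf ck] /andP[xS xy]].
  by rewrite move_root_rooted_forest //= ck tpermR xS adj_sym.
rewrite /weight (reindex_inj (inv_inj (move_rootK j i))).
apply: eq_bigl => f; apply/idP/idP => [/swap|/swap //].
by rewrite [move_root i j _]/move_root tpermC -/(move_root j i _) move_rootK.
Qed.

Lemma sum_weight_forests_at j k :
  \sum_i weight (forests_at G i j k) = weight (forests G k).
Proof.
under eq_bigr => i _ do rewrite weight_forests_at.
rewrite exchange_big; apply: eq_bigr => f; rewrite inE => /andP[rf _].
have [_ /(_ j)[r rS jr] _] := rooted_forestP _ rf.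
rewrite -mulr_sumr (bigD1 r) //= big1 ?addr0 => [|i ir].
  by rewrite /in_tree rS adj_sym jr mulr1.
rewrite /in_tree; have [iS /=|//] := boolP (i \in f.2).
have := roots_disconnected rf iS rS ir.
by have [ij|//] := boolP (connect _ i j); rewrite (connect_trans ij jr).
Qed.

(** Cutting the parent edge of a non-root trades one edge for one root, down to the forest without
    edges, where every vertex is a root. *)
Lemma card_rooted_forest f : rooted_forest f -> (#|f.1| + #|f.2| = n)%N.
Proof.
elim: {f}_.+1 {-2}f (ltnSn #|f.1|) => // m IHm f fm rf.
have [/existsP[j jS]|/existsPn allS] := boolP [exists j, j \notin f.2].
  have [e [h /and4P[eF _ _ rp]]] := parent_exists rf jS.
  move: (cardsD1 e f.1) fm; rewrite eF add1n => cF; rewrite cF ltnS => fm.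
  by have := IHm (prune e j f) fm rp; rewrite /= cardsU1 jS add1n addnS addSn.
have inS x : x \in f.2 by rewrite -[_ \in _]negbK allS.
have -> : f.1 = set0.
  apply/setP => e; rewrite inE; apply/negP => eF.
  have [/bridgeP/(_ _ eF _ _ (joins_ends e)) + _ unS] := rooted_forestP _ rf.
  have -> : (ends e).1 = (ends e).2; last by rewrite connect0.
  exact: unS (connect_joins eF (joins_ends e)).
have -> : f.2 = setT by apply/setP => x; rewrite inE inS.
by rewrite cards0 cardsT card_ord.
Qed.

(** * Maximal forests and the components of the graph *)

Lemma component_eq F x y : (component F x == component F y) = connect (adj F) x y.
Proof.
apply/eqP/idP => [/setP/(_ y)|xy]; first by rewrite !inE connect0.
by apply/setP => z; rewrite !inE; apply: same_connect xy z; apply: adj_sym.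
Qed.

Lemma ncomponents_roots f : rooted_forest f ->
  ncomponents G = #|[set component [set: edge G] r | r in f.2]|.
Proof.
case/rooted_forestP=> _ exS _; congr #|pred_of_set _|; apply/setP => C.
apply/imsetP/imsetP => -[x _ ->]; last by exists x.
have [r rS xr] := exS x; exists r => //; apply/eqP; rewrite component_eq.
exact: connect_subset (subsetT _) xr.
Qed.

(** Every component contains a root; with as many roots as components it contains exactly one, hence
    is a single tree. *)
Lemma connect_maximal_forest f x y : rooted_forest f -> #|f.2| = ncomponents G ->
  connect (adj [set: edge G]) x y = connect (adj f.1) x y.
Proof.
move=> rf; rewrite (ncomponents_roots rf) => /esym/eqP/imset_injP injC.
apply/idP/idP => [xy|]; last exact/connect_subset/subsetT.
have [_ exS _] := rooted_forestP _ rf.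
have [[r rS xr] [s sS ys]] := (exS x, exS y).
have rs : r = s.
  apply: injC => //; apply/eqP; rewrite component_eq.
  apply: connect_trans (connect_subset (subsetT _) ys).
  by apply: connect_trans xy; rewrite adj_sym (connect_subset (subsetT _) xr).
by apply: connect_trans xr _; rewrite adj_sym rs.
Qed.

Lemma connect_set0 x y : connect (adj (set0 : {set edge G})) x y -> x = y.
Proof. by case/connectP=> -[|z p] //= /andP[/adjP[e]]; rewrite inE. Qed.

(** In a rooted forest with the most edges, two roots in one component would leave an edge of [G]
    between different trees, along which one could graft. *)
Lemma maximal_forest_exists :
  exists2 f : {set edge G} * {set 'I_n}, rooted_forest f & #|f.2| = ncomponents G.
Proof.
have r0 : rooted_forest ((set0, setT) : {set edge G} * {set 'I_n}).
  apply/rooted_forestP; split=> /= [|x|r s _ _ /connect_set0 //].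
    by apply/bridgeP => e; rewrite inE.
  by exists x; rewrite ?inE ?connect0.
have [f rf maxf] :=
  arg_maxnP (fun f : {set edge G} * {set 'I_n} => #|f.1|) r0; exists f => //.
rewrite (ncomponents_roots rf); apply/esym/eqP/imset_injP => r s rS sS.
move/eqP; rewrite component_eq => rs.
have [_ exS unS] := rooted_forestP _ rf; apply: unS => //; move: rs.
apply: connect_sub => x y /adjP[e _ exy]; apply: contraT => Nxy.
have [t tS xt] := exS x.
(* Grafting along the edge at [x] needs [x] to be a root, so the root [t] of its tree is moved there
   first. *)
have rm : rooted_forest (move_root t x f).
  by apply: move_root_rooted_forest; rewrite // adj_sym.
have := maxf _ (graft_rooted_forest rm _ exy Nxy); rewrite /= inE tpermR.
move=> /(_ tS); rewrite cardsU1 (contra _ Nxy) ?add1n ?ltnn // => eF.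
exact: connect_joins eF exy.
Qed.

(** An integer: when no two distinct vertices are connected, [d - 1] is -1 and [forests G (d - 1)]
    is empty. *)
Let d : int := n%:Z - (ncomponents G)%:Z.

Lemma maximal_forestsP f : (f \in forests G d) =
  rooted_forest f && (#|f.2| == ncomponents G).
Proof.
rewrite inE; have [rf|//] := boolP (rooted_forest f).
rewrite eq_sym subr_eq -PoszD eqz_nat /=.
by rewrite -[RHS](eqn_add2l #|f.1|) (card_rooted_forest rf).
Qed.

Lemma weight_maximal_forests_gt0 : 0 < weight (forests G d).
Proof.
have w0 (f : {set edge G} * {set 'I_n}) : 0 < edges_weight f.
  by apply: prodr_gt0 => e _; apply: wt_gt0.
have [f rf cf] := maximal_forest_exists.
rewrite /weight (bigD1 f) ?maximal_forestsP ?rf ?cf ?eqxx //=.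
by rewrite ltr_wpDr ?w0 // sumr_ge0 // => g _; apply/ltW/w0.
Qed.

Lemma weight_forests_at_disconnected i j k :
  ~~ connect (adj [set: edge G]) i j -> weight (forests_at G i j k) = 0.
Proof.
move=> Nij; rewrite weight_forests_at big1 // => f _; rewrite /in_tree.
have [ij|_] := boolP (connect _ i j); last by rewrite andbF mulr0.
by case/negP: Nij; apply: connect_subset (subsetT _) ij.
Qed.

(** The trees of a maximal forest are the components, so the weight is the same for all [j] in the
    component of [i], and by symmetry for all [i] there. These equal entries of a column add up to
    the total. *)
Lemma weight_maximal_forests_at i j : weight (forests_at G i j d) =
  (j \in component [set: edge G] i)%:R / #|component [set: edge G] i|%:R
     * weight (forests G d).
Proof.
rewrite inE; have [ij|Nij] := boolP (connect _ i j); last first.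
  by rewrite weight_forests_at_disconnected // !mul0r.
have const x y : connect (adj [set: edge G]) x y ->
    weight (forests_at G x y d) = weight (forests_at G x x d).
  move=> xy; rewrite !weight_forests_at; apply: eq_bigr => f.
  rewrite maximal_forestsP => /andP[rf /eqP cf].
  by rewrite /in_tree -!(connect_maximal_forest _ _ rf cf) xy connect0.
rewrite const // -(sum_weight_forests_at i).
rewrite (bigID (mem (component [set: edge G] i))) /= addrC big1 ?add0r; last first.
  by move=> x; rewrite inE adj_sym => /weight_forests_at_disconnected.
rewrite (eq_bigr (fun=> weight (forests_at G i i d))); last first.
  by move=> x; rewrite inE weight_forests_atC => /const.
rewrite /= mul1r sumr_const -[X in _ * X]mulr_natl mulKf // pnatr_eq0 -lt0n.
by apply/card_gt0P; exists i; rewrite inE connect0.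
Qed.

(** * Matrix identities and the Moore-Penrose conditions *)

Let C := component [set: edge G].
Definition component_mean : 'M[R]_n := \matrix_(i, j) ((j \in C i)%:R / #|C i|%:R).
Definition forest_mx k : 'M[R]_n := \matrix_(i, j) weight (forests_at G i j k).
Local Notation J := component_mean.
Local Notation Q := forest_mx.
Local Notation L := (laplacian G).

Lemma mem_componentC i j : (j \in C i) = (i \in C j).
Proof. by rewrite !inE adj_sym. Qed.

Lemma component_same i j : j \in C i -> C i = C j.
Proof. by rewrite inE => ij; apply/eqP; rewrite component_eq. Qed.

Lemma component_mean_tr : J^T = J.
Proof.
apply/matrixP => i j; rewrite !mxE mem_componentC.
by have [/component_same->|] := boolP (j \in C i); rewrite ?mul0r.
Qed.

Lemma laplacian_tr : L^T = L.
Proof.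
apply/matrixP => i j; rewrite !mxE eq_sym.
by have [->|_] := eqVneq i j; rewrite // offdiagC.
Qed.

Lemma forest_mx_tr k : (Q k)^T = Q k.
Proof. by apply/matrixP => i j; rewrite !mxE weight_forests_atC. Qed.

(** Each row of [J] is constant on components, and an edge stays within one. *)
Lemma component_mean_laplacian : J *m L = 0.
Proof.
apply/matrixP => i j; rewrite mulmx_laplacian [RHS]mxE big1 // => p ejp.
rewrite !mxE; have jp : connect (adj [set: edge G]) j p.2.
  by apply: connect_joins ejp; rewrite inE.
suff -> : (j \in C i) = (p.2 \in C i) by rewrite subrr mulr0.
by rewrite ![_ \in C i]mem_componentC (@component_same j p.2) ?inE.
Qed.

(** Column [j] of [M] lives on the component of [j], where [J] replaces it by its average. Applied
    to [J] itself and to [Q k]. *)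
Lemma mul_component_mean (M : 'M[R]_n) (s : R) :
  (forall i j, j \notin C i -> M i j = 0) -> (forall j, \sum_i M i j = s) ->
  J *m M = s *: J.
Proof.
move=> M0 Ms; apply/matrixP => i j; rewrite !mxE.
have [ij|ij] := boolP (j \in C i); last first.
  rewrite mul0r mulr0 big1 // => h _; rewrite mxE.
  have [ih|_] := boolP (h \in C i); last by rewrite !mul0r.
  by rewrite M0 ?mulr0 // -(component_same ih).
rewrite -(Ms j) mulr_suml; apply: eq_bigr => h _; rewrite mxE.
have [ih|ih] := boolP (h \in C i); first by rewrite mulrC.
by rewrite M0 ?mul0r ?mulr0 // mem_componentC -(component_same ij).
Qed.

Lemma component_mean_idem : J *m J = J.
Proof.
rewrite (@mul_component_mean _ 1) ?scale1r // => [i j /negPf ij|j].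
  by rewrite mxE ij mul0r.
rewrite (bigID (mem (C j))) /= addrC big1 ?add0r => [|i]; last first.
  by rewrite mem_componentC mxE => /negPf->; rewrite mul0r.
rewrite (eq_bigr (fun=> #|C j|%:R^-1)) => [|i ji]; last first.
  by rewrite mxE mem_componentC ji mul1r (component_same ji).
rewrite sumr_const -[_ *+ _]mulr_natl mulfV // pnatr_eq0 -lt0n.
by apply/card_gt0P; exists j; rewrite inE connect0.
Qed.

Lemma component_mean_forest_mx k : J *m Q k = weight (forests G k) *: J.
Proof.
apply: mul_component_mean => [i j|j].
  by rewrite inE mxE; apply: weight_forests_at_disconnected.
by rewrite -(sum_weight_forests_at j); apply: eq_bigr => i _; rewrite mxE.
Qed.

Lemma forest_mx_laplacian k :
  Q k *m L = (weight (forests G (k + 1)))%:M - Q (k + 1).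
Proof.
apply/matrixP => i j; rewrite mulmx_laplacian !mxE.
under eq_bigr => p _ do rewrite !mxE.
have [->|ij] := eqVneq i j; first by rewrite forest_recursion_diag mulr1n.
rewrite mulr0n sub0r -(forest_recursion_offdiag _ ij) -sumrN.
by apply: eq_bigr => p _; rewrite -mulrN opprB.
Qed.

Lemma maximal_forest_mx : Q d = weight (forests G d) *: J.
Proof.
by apply/matrixP => i j; rewrite !mxE weight_maximal_forests_at mulrC.
Qed.

Lemma moore_penrose_forest_mx : moore_penrose L
  ((weight (forests G d))^-1 *: (Q (d - 1) - weight (forests G (d - 1)) *: J)).
Proof.
set s := weight (forests G d); set X := _ *: _.
have s0 : s != 0 by rewrite gt_eqF ?weight_maximal_forests_gt0.
have XL : X *m L = 1%:M - J.
  rewrite -scalemxAl mulmxBl forest_mx_laplacian subrK -scalemxAl.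
  rewrite component_mean_laplacian scaler0 subr0 maximal_forest_mx -/s.
  by rewrite -[s%:M]scalemx1 -scalerBr scalerA mulVf // scale1r.
have trX : X^T = X.
  rewrite /X -[in RHS]forest_mx_tr -[in RHS]component_mean_tr.
  by apply/matrixP => i k; rewrite !mxE.
have tr1J : (1%:M - J)^T = 1%:M - J.
  by rewrite linearB /= trmx1 component_mean_tr.
(* Transpose [X *m L = 1%:M - J], all matrices being symmetric. *)
have LX : L *m X = 1%:M - J.
  by rewrite -tr1J -XL trmx_mul trX laplacian_tr.
have JX : J *m X = 0.
  rewrite -scalemxAr mulmxBr component_mean_forest_mx -scalemxAr.
  by rewrite component_mean_idem subrr scaler0.
(* With both products equal to the symmetric [1%:M - J], only [J *m L = 0] and [J *m X = 0] are left
   to use. *)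
split; rewrite ?LX ?XL ?tr1J // mulmxBl mul1mx.
- by rewrite component_mean_laplacian subr0.
- by rewrite JX subr0.
Qed.

End Graph.

Theorem theorem3 (R : realFieldType) (n : nat) (G : wmultigraph R n)
    (Lp : 'M[R]_n) (hLp : moore_penrose (laplacian G) Lp) (i j : 'I_n) :
  let v := ncomponents G in
  let V := component [set: edge G] in
  Lp i j =
    if j \in V i then
      (weight (forests_at G i j (n%:Z - v%:Z - 1))
         - #|V i|%:R^-1 * weight (forests G (n%:Z - v%:Z - 1)))
      / weight (forests G (n%:Z - v%:Z))
    else 0.
Proof.
move=> v V; rewrite (moore_penrose_unique hLp (moore_penrose_forest_mx G)) !mxE.
rewrite -/V -/v; have [ij|ij] := boolP (j \in V i).
  by rewrite mul1r mulrC; congr ((_ - _) / _); apply: mulrC.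
rewrite weight_forests_at_disconnected; last by rewrite inE in ij.
by rewrite mul0r mulr0 subr0 mulr0.
Qed.
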